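(* Consider a single pursuer $P$ and a single evader $E$ with stacked control sequences $\bm{U}^{(P)},\bm{U}^{(E)}\in\mathbb{R}^{2N}$, terminal relative position $\bm{\delta}=G_P\bm{U}^{(P)}-G_E\bm{U}^{(E)}+\bm{g}_0\in\mathbb{R}^{2}$, where $G_P$, $G_E$, $\bm{g}_0$ are as defined in the context, and payoff $$J(\bm{U}^{(P)},\bm{U}^{(E)})=\|\bm{\delta}\|_2^2+\lambda\|\bm{U}^{(P)}\|_2^2-\lambda\|\bm{U}^{(E)}\|_2^2 .$$ Let $\sigma_{\max}(G_E)$ denote the largest singular value of $G_E$. For every $\lambda>0$: (1) $J$ is strictly convex in $\bm{U}^{(P)}$ (for each fixed $\bm{U}^{(E)}$); (2) $J$ is concave in $\bm{U}^{(E)}$ (for each fixed $\bm{U}^{(P)}$) if and only if $\lambda\ge\sigma_{\max}(G_E)^2$; (3) the game operator $F(\bm{U}^{(P)},\bm{U}^{(E)})=\bigl[\nabla_{\bm{U}^{(P)}}J,\;-\nabla_{\bm{U}^{(E)}}J\bigr]^\top$ is monotone, i.e. $(F(\bm{z})-F(\bm{z}'))^\top(\bm{z}-\bm{z}')\ge0$ for all $\bm{z},\bm{z}'\in\mathbb{R}^{2N}\times\mathbb{R}^{2N}$, if and only if $\lambda\ge\sigma_{\max}(G_E)^2$.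
   Context: Dynamics (planar Hill--Clohessy--Wiltshire model). The state is $\bm{x}=[x,y,\dot x,\dot y]^\top\in\mathbb{R}^4$, the control is $\bm{u}=[u_x,u_y]^\top\in\mathbb{R}^2$, and the position is $\bm{r}=[x,y]^\top$. The continuous-time system $\dot{\bm{x}}=A_c\bm{x}+B_c\bm{u}$ is $\ddot x-2n\dot y-3n^2x=u_x$, $\ddot y+2n\dot x=u_y$, with $n>0$. For a timestep $\Delta t>0$, $A_d\in\mathbb{R}^{4\times4}$ and $B_d\in\mathbb{R}^{4\times2}$ are given by $\exp\!\left(\begin{bmatrix}A_c&B_c\\0&0\end{bmatrix}\Delta t\right)=\begin{bmatrix}A_d&B_d\\0&I\end{bmatrix}$. Each agent $j\in\{P,E\}$ evolves by $\bm{x}^{(j)}_{k}=A_d\bm{x}^{(j)}_{k-1}+B_d\bm{u}^{(j)}_{k-1}$, $k=1,\dots,N$, from a given initial state $\bm{x}_0^{(j)}$, with horizon $N\ge1$. Stacking. $\bm{U}^{(j)}\in\mathbb{R}^{2N}$ stacks $\bm{u}^{(j)}_0,\dots,\bm{u}^{(j)}_{N-1}$. The stacked state trajectory is the affine function $\bm{X}^{(j)}=\bm{f}^{(j)}+S\bm{U}^{(j)}$, where $\bm{f}^{(j)}$ is the free (zero-control) response from $\bm{x}_0^{(j)}$ and $S$ is the block-lower-triangular matrix with blocks $S_{k,m}=A_d^{k-m-1}B_d$ for $m<k$ and zero otherwise. $T_N$ is the matrix extracting the terminal position, $T_N\bm{X}^{(j)}=\bm{r}_N^{(j)}$. Then $G_P=G_E=T_NS\in\mathbb{R}^{2\times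 2N}$, whose block column for $\bm{u}_m$ is the position (first two) rows of $A_d^{N-1-m}B_d$, and $\bm{g}_0=T_N(\bm{f}^{(P)}-\bm{f}^{(E)})$, so $\bm{\delta}=\bm{r}_N^{(P)}-\bm{r}_N^{(E)}$. *)

(* Defs.v *)
From mathcomp Require Import all_boot all_order all_algebra.
From mathcomp Require Import all_classical all_reals all_analysis.

Set Implicit Arguments.
Unset Strict Implicit.
Unset Printing Implicit Defensive.

Import Order.TTheory GRing.Theory Num.Theory.
Import numFieldNormedType.Exports.

Local Open Scope classical_set_scope.
Local Open Scope ring_scope.

Section Euclidean.
Variable R : realType.

Definition dotv d (u v : 'cV[R]_d) : R := (u^T *m v) 0 0.

(* The library norm `|v| on matrices is the sup norm, hence this definition. *)
Definition norm2 d (v : 'cV[R]_d) : R := Num.sqrt (\sum_i v i 0 ^+ 2).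

Definition singular_values p q (A : 'M[R]_(p, q)) : set R :=
  [set s | 0 <= s /\ eigenvalue (A^T *m A) (s ^+ 2)].

(* For 0 < q the set is finite and nonempty, so the supremum is its maximum. *)
Definition sigma_max p q (A : 'M[R]_(p, q)) : R := sup (singular_values A).

Definition gradient d (f : 'cV[R]_d -> R) (x : 'cV[R]_d) : 'cV[R]_d :=
  \col_i 'D_(delta_mx i 0) f x.

Definition strictly_convex d (f : 'cV[R]_d -> R) : Prop :=
  forall (x y : 'cV[R]_d) (t : R), x != y -> 0 < t -> t < 1 ->
    f (t *: x + (1 - t) *: y) < t * f x + (1 - t) * f y.

Definition concave d (f : 'cV[R]_d -> R) : Prop :=
  convex_function [set: 'cV[R]_d] (\- f).

Definition monotone_operator d (F : 'cV[R]_d -> 'cV[R]_d) : Prop :=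
  forall z z' : 'cV[R]_d, 0 <= dotv (F z - F z') (z - z').

End Euclidean.

Section MatrixExponential.
Variable R : realType.

Definition expmx_coeff d (A : 'M[R]_d) (k : nat) : 'M[R]_d :=
  (k`!%:R)^-1 *: A ^+ k.

Definition expmx d (A : 'M[R]_d) : 'M[R]_d := limn (series (expmx_coeff A)).

Lemma is_cvg_expmx d (A : 'M[R]_d) : cvgn (series (expmx_coeff A)).
Proof.
set C : R := d%:R * `|A|.
have C0 : 0 <= C by rewrite mulr_ge0.
have nle (B : 'M[R]_d) i j : `|B i j| <= `|B|.
  by rewrite [leRHS]/Num.norm /= mx_normrE; apply/bigmax_geP; right; exists (i, j).
have powle k i j : `|(A ^+ k) i j| <= C ^+ k.
  elim: k i j => [|k IH] i j.
    by rewrite !expr0 mxE; case: eqP => _; rewrite ?normr1 ?normr0.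
  rewrite exprS mxE (le_trans (ler_norm_sum _ _ _))//.
  apply: (@le_trans _ _ (\sum_(l < d) `|A| * C ^+ k)).
    by apply: ler_sum => l _; rewrite normrM ler_pM.
  by rewrite sumr_const card_ord exprS -[leLHS]mulr_natl mulrA.
suff /cauchy_cvgP/cauchy_seriesP ncvg : cvgn [normed series (expmx_coeff A)].
  apply/cauchy_cvgP/cauchy_seriesP => e /ncvg; apply: filterS => k /=.
  by rewrite ger0_norm ?sumr_ge0//; apply: le_lt_trans; exact: ler_norm_sum.
apply: (series_le_cvg _ _ _ (is_cvg_series_exp_coeff C)) => [k|k|k].
- exact: normr_ge0.
- exact: exp_coeff_ge0.
rewrite /exp_coeff /expmx_coeff /= [leLHS]/Num.norm /= mx_normrE.
apply/bigmax_leP; split=> [|[i j] _ /=]; first exact: exp_coeff_ge0.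
by rewrite mxE normrM mulrC (@ger0_norm _ _^-1) ?invr_ge0// ler_wpM2r ?invr_ge0.
Qed.

End MatrixExponential.

Section HCW.
Variable R : realType.

(* State [x, y, x', y'], control [u_x, u_y]. *)
Definition hcw_A (n : R) : 'M[R]_4 :=
  \matrix_(i, j) nth 0 (nth [::]
    [:: [:: 0;          0; 1;         0];
        [:: 0;          0; 0;         1];
        [:: 3 * n ^+ 2; 0; 0;         2 * n];
        [:: 0;          0; - (2 * n); 0]] i) j.

Definition hcw_B : 'M[R]_(4, 2) :=
  \matrix_(i, j) nth 0 (nth [::]
    [:: [:: 0; 0];
        [:: 0; 0];
        [:: 1; 0];
        [:: 0; 1]] i) j.

Definition zoh_exp (n dt : R) : 'M[R]_(4 + 2) :=
  expmx (dt *: block_mx (hcw_A n) hcw_B 0 0).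

(* [zoh_expE] below shows that the two lower blocks are 0 and I. *)
Definition hcw_Ad (n dt : R) : 'M[R]_4 := ulsubmx (zoh_exp n dt).
Definition hcw_Bd (n dt : R) : 'M[R]_(4, 2) := ursubmx (zoh_exp n dt).

Lemma zoh_expE (n dt : R) :
  zoh_exp n dt = block_mx (hcw_Ad n dt) (hcw_Bd n dt) 0 1%:M.
Proof.
rewrite -[LHS]submxK /hcw_Ad /hcw_Bd.
set M : 'M[R]_(4 + 2) := dt *: block_mx (hcw_A n) hcw_B 0 0.
have cvgE : series (expmx_coeff M) @ \oo --> zoh_exp n dt.
  exact: is_cvg_expmx.
have dsubS k : dsubmx (M ^+ k.+1 : 'M[R]_(4 + 2)) = 0.
  rewrite exprS -mul_dsub_mx (_ : dsubmx M = 0) ?mul0mx//.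
  by rewrite /M linearZ/= block_mxEv col_mxKd row_mx0 scaler0.
have dsubE : dsubmx (zoh_exp n dt) = row_mx 0 1%:M.
  apply/matrixP => i j.
  have cij : (fun k => series (expmx_coeff M) k (rshift 4 i) j) @ \oo -->
      zoh_exp n dt (rshift 4 i) j.
    exact: (cvg_comp _ _ cvgE (@coord_continuous _ _ _ _ _ _)).
  rewrite mxE -(cvg_lim (@Rhausdorff R) cij).
  apply: lim_near_cst; first exact: Rhausdorff.
  near=> k.
  have /ltn_predK <- : (0 < k)%N by near: k; exists 1%N.
  rewrite /series /= big_nat_recl//.
  transitivity ((dsubmx (expmx_coeff M 0 + \sum_(0 <= l < k.-1) expmx_coeff M l.+1)) i j).
    by rewrite [RHS]mxE.
  rewrite linearD linear_sum/= big1 ?addr0 => [|l _]; last first.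
    by rewrite /expmx_coeff linearZ/= dsubS scaler0.
  rewrite /expmx_coeff fact0 invr1 scale1r expr0.
  by rewrite -[1]/(1%:M) (@scalar_mx_block _ 4 2) block_mxEv col_mxKd.
by rewrite /dlsubmx /drsubmx dsubE row_mxKl row_mxKr.
Unshelve. all: by end_near. Qed.

Definition pos_rows q (X : 'M[R]_(4, q)) : 'M[R]_(2, q) :=
  usubmx (X : 'M[R]_(2 + 2, q)).

Variables (n dt : R) (N : nat).
Local Notation Ad := (hcw_Ad n dt).
Local Notation Bd := (hcw_Bd n dt).

Fixpoint hcw_state (x0 : 'cV[R]_4) (u : nat -> 'cV[R]_2) (k : nat) :
    'cV[R]_4 :=
  if k is k'.+1 then Ad *m hcw_state x0 u k' + Bd *m u k' else x0.

(* The dimension of a stacked control, in the form used by the library for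
   block matrices; it equals 2 * N by [udimE]. *)
Definition udim : nat := \sum_(m < N) 2.

Definition xdim : nat := \sum_(k < N) 4.

(* Block row k of the stacked trajectory is the state at time k + 1. *)
Definition free_response (x0 : 'cV[R]_4) : 'cV[R]_xdim :=
  \mxcol_(k < N) hcw_state x0 (fun=> 0) k.+1.

(* As block row k stands for time k + 1, the exponent (k + 1) - m - 1 is
   k - m, and the condition m < k + 1 is m <= k. *)
Definition forced_response : 'M[R]_(xdim, udim) :=
  \mxblock_(k < N, m < N)
    (if (m <= k)%N then Ad ^+ (k - m) *m Bd else 0 : 'M[R]_(4, 2)).

Definition terminal_pos : 'M[R]_(2, xdim) :=
  \mxrow_(k < N)
    (if k.+1 == N then pos_rows 1%:M else 0 : 'M[R]_(2, 4)).

Definition hcw_G : 'M[R]_(2, udim) := terminal_pos *m forced_response.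

Definition hcw_g0 (xP xE : 'cV[R]_4) : 'cV[R]_2 :=
  terminal_pos *m (free_response xP - free_response xE).

Lemma udimE : udim = (2 * N)%N.
Proof. by rewrite /udim sum_nat_const card_ord mulnC. Qed.

Lemma stacked_stateE (x0 : 'cV[R]_4) (u : nat -> 'cV[R]_2) :
  \mxcol_(k < N) hcw_state x0 u k.+1 =
  free_response x0 + forced_response *m \mxcol_(m < N) u m.
Proof.
have stateE k : hcw_state x0 u k = hcw_state x0 (fun=> 0) k +
    \sum_(m < k) Ad ^+ (k - m.+1) *m Bd *m u m.
  elim: k => [|k IH]; first by rewrite big_ord0 addr0.
  rewrite big_ord_recr /= subnn expr0 mul1mx IH mulmxDr mulmx0 addr0 -addrA.
  congr (_ + (_ + _)); rewrite mulmx_sumr; apply: eq_bigr => m _.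
  by rewrite subSn // exprS !mulmxA.
rewrite /free_response /forced_response mxblockEv mxcol_mul -mxcolD.
apply: eq_mxcol => k; rewrite mul_mxrow_mxcol stateE; congr (_ + _).
rewrite (big_ord_widen N (fun m => Ad ^+ (k.+1 - m.+1) *m Bd *m u m))//.
rewrite big_mkcond; apply: eq_bigr => m _ /=.
by rewrite ltnS subSS; case: ifP; rewrite ?mul0mx.
Qed.

Lemma terminal_posE (x : nat -> 'cV[R]_4) : (0 < N)%N ->
  terminal_pos *m \mxcol_(k < N) x k.+1 = pos_rows (x N).
Proof.
move=> N0; rewrite /terminal_pos mul_mxrow_mxcol.
have ltN : (N.-1 < N)%N by rewrite prednK.
rewrite (bigD1 (Ordinal ltN))//= prednK// eqxx big1 ?addr0 => [|k kN].
  by rewrite /pos_rows mul_usub_mx mul1mx.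
case: eqP => [kE|]; last by rewrite mul0mx.
by case/eqP: kN; apply/val_inj => /=; move: kE => /(congr1 predn) /=.
Qed.

Lemma hcw_GE : (0 < N)%N ->
  hcw_G = \mxrow_(m < N) pos_rows (Ad ^+ (N - 1 - m) *m Bd).
Proof.
move=> N0; rewrite /hcw_G /terminal_pos /forced_response mul_mxrow_mxblock.
have ltN : (N.-1 < N)%N by rewrite prednK.
apply: eq_mxrow => m.
rewrite (bigD1 (Ordinal ltN))//= prednK// eqxx big1 ?addr0 => [|k kN].
  by rewrite -ltnS prednK// ltn_ord subn1 /pos_rows mul_usub_mx mul1mx.
case: eqP => [kE|]; last by rewrite mul0mx.
by case/eqP: kN; apply/val_inj => /=; move: kE => /(congr1 predn) /=.
Qed.

Variables (xP xE : 'cV[R]_4) (lambda : R).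

(* G_P = G_E = [hcw_G]. *)
Definition delta (UP UE : 'cV[R]_udim) : 'cV[R]_2 :=
  hcw_G *m UP - hcw_G *m UE + hcw_g0 xP xE.

Definition payoff (UP UE : 'cV[R]_udim) : R :=
  norm2 (delta UP UE) ^+ 2 + lambda * norm2 UP ^+ 2 - lambda * norm2 UE ^+ 2.

Lemma deltaE (uP uE : nat -> 'cV[R]_2) : (0 < N)%N ->
  delta (\mxcol_(m < N) uP m) (\mxcol_(m < N) uE m) =
  pos_rows (hcw_state xP uP N) - pos_rows (hcw_state xE uE N).
Proof.
move=> N0; rewrite -!terminal_posE// !stacked_stateE /delta /hcw_G /hcw_g0.
by rewrite -!mulmxA !mulmxDr mulmxN opprD addrC addrACA.
Qed.

(* A point of the product space is encoded by stacking its components. *)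
Definition game_operator (z : 'cV[R]_(udim + udim)) : 'cV[R]_(udim + udim) :=
  let UP := usubmx z in let UE := dsubmx z in
  col_mx (gradient (fun V => payoff V UE) UP)
         (- gradient (fun V => payoff UP V) UE).

End HCW.

(* Main.v *)
(* In each player's control the payoff is |G x + b|^2 + k |x|^2 + c with k =
   lambda for P and k = - lambda for E, so convexity and concavity are decided
   by the sign of the form |G h|^2 + k |h|^2. In <F z - F z', z - z'> the
   cross terms between the players cancel, leaving 2 (|G p|^2 + lambda |p|^2)
   + 2 (lambda |e|^2 - |G e|^2) with (p, e) = z - z'; as p and e are
   independent, concavity and monotonicity both say that |G e|^2 <= lambda
   |e|^2 for all e. The least such lambda is sigma_max(G)^2, because the
   Rayleigh quotient |G e|^2 / |e|^2 is maximal, by compactness of the sphere,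
   at an eigenvector of G^T G. *)

Require Import Defs.
From mathcomp Require Import all_boot all_order all_algebra ring lra.
From mathcomp Require Import all_classical all_reals all_analysis.

Set Implicit Arguments.
Unset Strict Implicit.

Import Order.TTheory GRing.Theory Num.Theory.
Import numFieldNormedType.Exports.

Local Open Scope classical_set_scope.
Local Open Scope ring_scope.

(** * Euclidean inner product on column vectors *)

Section DotProduct.
Context {R : realType}.

Lemma dotvE {d} (u v : 'cV[R]_d) : dotv u v = \sum_i u i 0 * v i 0.
Proof. by rewrite /dotv mxE; apply: eq_bigr => i _; rewrite mxE. Qed.

Lemma dotvC {d} (u v : 'cV[R]_d) : dotv u v = dotv v u.
Proof. by rewrite !dotvE; apply: eq_bigr => i _; rewrite mulrC. Qed.

Lemma dotvDr {d} (u v w : 'cV[R]_d) : dotv u (v + w) = dotv u v + dotv u w.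
Proof. by rewrite /dotv mulmxDr mxE. Qed.

Lemma dotvZr {d} a (u v : 'cV[R]_d) : dotv u (a *: v) = a * dotv u v.
Proof. by rewrite /dotv -scalemxAr mxE. Qed.

Lemma dotvNr {d} (u v : 'cV[R]_d) : dotv u (- v) = - dotv u v.
Proof. by rewrite -scaleN1r dotvZr mulN1r. Qed.

Lemma dotvDl {d} (u v w : 'cV[R]_d) : dotv (u + v) w = dotv u w + dotv v w.
Proof. by rewrite !(dotvC _ w) dotvDr. Qed.

Lemma dotvZl {d} a (u v : 'cV[R]_d) : dotv (a *: u) v = a * dotv u v.
Proof. by rewrite !(dotvC _ v) dotvZr. Qed.

Lemma dotvNl {d} (u v : 'cV[R]_d) : dotv (- u) v = - dotv u v.
Proof. by rewrite !(dotvC _ v) dotvNr. Qed.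

Definition dotv_lin := (@dotvDl, @dotvDr, @dotvZl, @dotvZr, @dotvNl, @dotvNr).

Lemma dotv_trmul {p q} (A : 'M[R]_(p, q)) u v :
  dotv (A^T *m u) v = dotv u (A *m v).
Proof. by rewrite /dotv trmx_mul trmxK mulmxA. Qed.

Lemma dotv_delta {d} (u : 'cV[R]_d) i : dotv u (delta_mx i 0) = u i 0.
Proof.
rewrite dotvE (bigD1 i)//= mxE !eqxx mulr1 big1 ?addr0// => j /negbTE ji.
by rewrite mxE ji mulr0.
Qed.

Lemma dotvv_ge0 {d} (u : 'cV[R]_d) : 0 <= dotv u u.
Proof. by rewrite dotvE sumr_ge0// => i _; rewrite -expr2 sqr_ge0. Qed.

Lemma dotvv_eq0 {d} (u : 'cV[R]_d) : (dotv u u == 0) = (u == 0).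
Proof.
apply/idP/eqP => [|->]; last by rewrite /dotv mulmx0 mxE.
rewrite dotvE psumr_eq0 => [/allP u0|i _]; last by rewrite -expr2 sqr_ge0.
apply/matrixP => i j; rewrite ord1 mxE; apply/eqP.
by have := u0 i (mem_index_enum _); rewrite /= mulf_eq0 orbb.
Qed.

Lemma dotvv_gt0 {d} (u : 'cV[R]_d) : (0 < dotv u u) = (u != 0).
Proof. by rewrite lt0r dotvv_ge0 dotvv_eq0 andbT. Qed.

Lemma norm2_sqr {d} (u : 'cV[R]_d) : norm2 u ^+ 2 = dotv u u.
Proof.
rewrite /norm2 sqr_sqrtr ?dotvE.
  by apply: eq_bigr => i _; rewrite expr2.
by apply: sumr_ge0 => i _; rewrite sqr_ge0.
Qed.

Lemma dotv_col_mx {p q} (u u' : 'cV[R]_p) (v v' : 'cV[R]_q) :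
  dotv (col_mx u v) (col_mx u' v') = dotv u u' + dotv v v'.
Proof. by rewrite /dotv tr_col_mx mul_row_col mxE. Qed.

End DotProduct.

(** * Convexity, concavity and gradient of [|A x + b|^2 + k |x|^2 + c] *)

Section QuadraticFunction.
Variables (R : realType) (p q : nat) (A : 'M[R]_(p, q)) (b : 'cV[R]_p) (k c : R).

Definition quadf (x : 'cV[R]_q) : R :=
  dotv (A *m x + b) (A *m x + b) + k * dotv x x + c.

(** Half the Hessian form of [quadf], whose Hessian is [2 (A^T A + k I)] at every point. *)
Definition hessform (h : 'cV[R]_q) : R := dotv (A *m h) (A *m h) + k * dotv h h.

Lemma hessform0 : hessform 0 = 0.
Proof. by rewrite /hessform mulmx0 /dotv !mulmx0 !mxE mulr0 addr0. Qed.

Lemma quadf_conv x y t :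
  quadf (t *: x + (1 - t) *: y) =
  t * quadf x + (1 - t) * quadf y - t * (1 - t) * hessform (x - y).
Proof.
rewrite /quadf /hessform !mulmxDr -!scalemxAr mulmxN !dotv_lin.
rewrite (dotvC y x) (dotvC (A *m y) (A *m x)) !(dotvC b); ring.
Qed.

(** The exact second-order Taylor expansion, from which the gradient is read off. *)
Lemma quadf_shift x v h :
  quadf (h *: v + x) =
  quadf x + h * dotv (2 *: (A^T *m (A *m x + b) + k *: x)) v + h ^+ 2 * hessform v.
Proof.
rewrite /quadf /hessform [A *m (_ + _)]mulmxDr -!scalemxAr.
rewrite !dotv_lin !dotv_trmul !dotv_lin.
rewrite (dotvC v x) (dotvC (A *m v) (A *m x)) !(dotvC b); ring.
Qed.

Lemma gradient_quadf x : gradient quadf x = 2 *: (A^T *m (A *m x + b) + k *: x).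
Proof.
apply/colP => i; rewrite mxE -[RHS]dotv_delta.
set v := delta_mx i 0; set a := dotv _ v.
apply: cvg_lim; first exact: Rhausdorff.
(* By the exact expansion, the difference quotient along [v] equals [a + h * hessform v] for every
   nonzero [h]. *)
have lim_affine : a + h * hessform v @[h --> 0^'] --> a.
  have : a + h * hessform v @[h --> 0^'] --> a + 0 * hessform v.
    apply: cvgD; first exact: cvg_cst.
    by apply: cvgM; [exact: nbhs_dnbhs | exact: cvg_cst].
  by rewrite mul0r addr0.
apply: cvg_trans lim_affine.
apply: near_eq_cvg; near=> h => /=.
have h0 : h != 0 by near: h; exact: nbhs_dnbhs_neq.
rewrite /shift/= quadf_shift -/a /GRing.scale/=.
by field.
Unshelve. all: by end_near. Qed.

Lemma strictly_convex_quadf :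
  (forall h, h != 0 -> 0 < hessform h) -> strictly_convex quadf.
Proof.
move=> hess_gt0 x y t xy t0 t1; rewrite quadf_conv gtrBl.
by rewrite mulr_gt0 ?hess_gt0 ?subr_eq0// mulr_gt0// subr_gt0.
Qed.

Lemma concave_quadf : concave quadf <-> forall h, hessform h <= 0.
Proof.
split=> [cq h|hess_le0 t x y _ _]; last first.
  change (- quadf (t%:num *: x + (1 - t%:num) *: y) <=
          t%:num * - quadf x + (1 - t%:num) * - quadf y).
  rewrite quadf_conv.
  suff : t%:num * (1 - t%:num) * hessform (x - y) <= 0 by lra.
  by rewrite mulr_ge0_le0// mulr_ge0// subr_ge0.
(* Concavity at the midpoint of [h] and 0 already gives [hessform h / 4 <= 0]. *)
have half_ge0 : 0 <= 2^-1 :> R by lra.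
have half_le1 : 2^-1 <= 1 :> R by lra.
have := cq (Itv01 half_ge0 half_le1) h 0 (in_setT _) (in_setT _).
change (- quadf (2^-1 *: h + (1 - 2^-1) *: 0) <=
        2^-1 * - quadf h + (1 - 2^-1) * - quadf 0 -> hessform h <= 0).
rewrite quadf_conv subr0; lra.
Qed.

End QuadraticFunction.

(** * The largest singular value as the maximum of a Rayleigh quotient *)

Section SingularValues.
Variables (R : realType) (p q : nat) (A : 'M[R]_(p, q)).

Lemma continuous_sumr {T : topologicalType} {m} (F : 'I_m -> T -> R) :
  (forall i, continuous (F i)) -> continuous (fun v => \sum_i F i v).
Proof.
by move=> cF v; apply: cvg_big => [|i _]; [exact: add_continuous | exact: cF].
Qed.

Lemma continuous_sqnorm {m} (B : 'M[R]_(m, q)) :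
  continuous (fun v : 'rV[R]_q => dotv (B *m v^T) (B *m v^T)).
Proof.
have BE i :
    (fun v : 'rV[R]_q => (B *m v^T) i 0) = fun v => \sum_j B i j * v 0 j.
  by apply/funext => v; rewrite mxE; apply: eq_bigr => j _; rewrite mxE.
have cB i : continuous (fun v : 'rV[R]_q => (B *m v^T) i 0).
  rewrite BE; apply: continuous_sumr => j v.
  by apply: continuousM; [exact: cst_continuous | exact: coord_continuous].
rewrite (_ : (fun v => _) = fun v => \sum_i (B *m v^T) i 0 * (B *m v^T) i 0).
  apply: continuous_sumr => i v.
  by apply: continuousM; exact: cB.
by apply/funext => v; rewrite dotvE.
Qed.

(** The sphere is a closed subset of the compact cube [[-1, 1]^q]. Row vectors match the form of
    [rV_compact] and [EVT_max_rV]. *)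
Lemma sphere_compact : compact [set v : 'rV[R]_q | dotv v^T v^T = 1].
Proof.
have cube : compact [set v : 'rV[R]_q | forall i, v ord0 i \in `[(-1 : R), 1]].
  apply: (@rV_compact _ _ (fun=> `[(-1 : R), 1]%classic)) => i.
  exact: segment_compact.
apply: subclosed_compact cube _ => [|v /= v1 i].
  have sqE : (fun w : 'rV[R]_q => dotv w^T w^T) =
             fun w => dotv (1%:M *m w^T) (1%:M *m w^T).
    by apply/funext => w; rewrite mul1mx.
  have -> : [set w : 'rV[R]_q | dotv w^T w^T = 1] =
            (fun w => dotv (1%:M *m w^T) (1%:M *m w^T)) @^-1` [set r | r = 1].
    by rewrite -sqE.
  apply: preimage_closed; last exact: closed_eq.
  by move=> w _; exact: continuous_sqnorm.
rewrite in_itv/= -ler_norml -[leRHS]normr1 -ler_sqr ?nnegrE// ?normr_ge0//.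
rewrite !real_normK ?num_real// expr1n -v1 dotvE (bigD1 i)//= !mxE -expr2 lerDl.
by apply: sumr_ge0 => j _; rewrite !mxE -expr2 sqr_ge0.
Qed.

(** An eigenvector [v] of [A^T A] for [s ^+ 2] satisfies [|A v|^2 = s^2 |v|^2] with [|v|^2 > 0].
    Eigenvectors are rows here, hence the transposes. *)
Lemma singular_values_le s l : singular_values A s ->
  (forall v, dotv (A *m v) (A *m v) <= l * dotv v v) -> s ^+ 2 <= l.
Proof.
move=> [s0 /eigenvalueP[v vE v0]] /(_ v^T).
have vT0 : 0 < dotv v^T v^T.
  by rewrite dotvv_gt0 -[0]trmx0 (inj_eq (can_inj (@trmxK _ _ _))).
have AvE : A^T *m (A *m v^T) = s ^+ 2 *: v^T.
  by apply/trmx_inj; rewrite !trmx_mul !trmxK -mulmxA vE linearZ/= trmxK.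
by rewrite -dotv_trmul AvE dotv_lin ler_pM2r.
Qed.

(* At a maximizer c of |A v|^2 on the sphere the nonnegative form mu |v|^2 -
   |A v|^2 vanishes, so its derivative at c in the direction w = mu c - A^T A
   c, which is 2 |w|^2, vanishes too. *)
Lemma singular_values_max : (0 < q)%N ->
  exists2 s, singular_values A s &
    forall v, dotv (A *m v) (A *m v) <= s ^+ 2 * dotv v v.
Proof.
move=> q0.
have [|c] := EVT_max_rV _ sphere_compact
  (continuous_subspaceT (@continuous_sqnorm _ A)).
  exists (delta_mx 0 (Ordinal q0)) => /=.
  by rewrite trmx_delta dotv_delta mxE !eqxx.
rewrite inE/= => c1 cmax; set mu := dotv _ _ in cmax.
have mu0 : 0 <= mu by exact: dotvv_ge0.
have Amu v : dotv (A *m v) (A *m v) <= mu * dotv v v.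
  have [->|v0] := eqVneq v 0; first by rewrite mulmx0 /dotv !mulmx0 !mxE mulr0.
  have nv : 0 < dotv v v by rewrite dotvv_gt0.
  (* Scaling by [a = 1 / |v|] brings [v] to the sphere, where [mu] is the maximum. *)
  set a := (Num.sqrt (dotv v v))^-1.
  have aE : a * a = (dotv v v)^-1 by rewrite -expr2 exprVn sqr_sqrtr// ltW.
  have := cmax (a *: v^T).
  rewrite inE/= linearZ/= trmxK -scalemxAr !dotv_lin !mulrA aE.
  by rewrite mulVf ?gt_eqF// => /(_ erefl); rewrite mulrC ler_pdivrMr.
exists (Num.sqrt mu); last by move=> v; rewrite sqr_sqrtr.
split; first exact: sqrtr_ge0.
rewrite sqr_sqrtr//; apply/eigenvalueP; exists c; last first.
  apply/eqP => c0; move: c1; rewrite c0 trmx0 /dotv mulmx0 mxE => /esym/eqP.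
  by rewrite oner_eq0.
apply/trmx_inj; rewrite !trmx_mul trmxK linearZ/=.
set x := c^T.
have [w wE] : {w | w = mu *: x - A^T *m (A *m x)} by eexists.
suff /eqP : w = 0 by rewrite wE subr_eq0 -mulmxA => /eqP ->.
apply/eqP; rewrite -dotvv_eq0.
set a := dotv w w; set b := mu * a - dotv (A *m w) (A *m w).
have a0 : 0 <= a by exact: dotvv_ge0.
have b0 : 0 <= b by rewrite subr_ge0.
(* This is [mu |.|^2 - |A .|^2] at [x + t w]; the constant term vanishes because [x] is a unit
   maximizer. *)
have quad t : 0 <= 2 * t * a + t ^+ 2 * b.
  have aE : a = mu * dotv x w - dotv (A *m x) (A *m w).
    by rewrite /a {1}wE !dotv_lin dotv_trmul.
  have := Amu (x + t *: w); rewrite mulmxDr -scalemxAr !dotv_lin.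
  rewrite (dotvC w x) (dotvC (A *m w) (A *m x)) -/mu c1 -/a /b.
  by move: (congr1 (fun r => 2 * t * r) aE); lra.
(* A small negative [t] would make the polynomial negative unless [a = 0]; dividing by [b + 1]
   rather than [b] covers the case [b = 0]. *)
have := quad (- a / (b + 1)); have b1 : b + 1 != 0 by rewrite gt_eqF//; lra.
have -> : 2 * (- a / (b + 1)) * a + (- a / (b + 1)) ^+ 2 * b =
          - (a ^+ 2 * ((b + 2) / (b + 1) ^+ 2)) by field.
rewrite oppr_ge0 pmulr_lle0 ?divr_gt0 ?exprn_gt0//; [|lra..].
by rewrite -sqrf_eq0 eq_le sqr_ge0 andbT.
Qed.

(** The singular value [s] that bounds the Rayleigh quotient also bounds all singular values, so the
    supremum is attained at [s]. *)
Lemma sigma_max_sqr_le l : (0 < q)%N ->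
  sigma_max A ^+ 2 <= l <->
  forall v, dotv (A *m v) (A *m v) <= l * dotv v v.
Proof.
move=> q0; have [s As smax] := singular_values_max q0.
have s_ub : ubound (singular_values A) s.
  move=> r Ar; have := singular_values_le Ar smax.
  by rewrite ler_sqr// nnegrE; [case: Ar | case: As].
have -> : sigma_max A = s.
  apply/le_anti/andP; split; first by apply: ge_sup => //; exists s.
  by apply: ub_le_sup => //; exists s.
split=> [sl v|]; last exact: singular_values_le.
by rewrite (le_trans (smax v))// ler_wpM2r// dotvv_ge0.
Qed.

End SingularValues.

(** * The payoff as a quadratic function of each control, and the game operator *)

Section Payoff.
Variables (R : realType) (n dt : R) (N : nat) (xP xE : 'cV[R]_4) (lambda : R).
Local Notation G := (hcw_G n dt N).
Local Notation g0 := (hcw_g0 n dt N xP xE).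
Local Notation payoff := (payoff n dt xP xE lambda).

Lemma payoff_quadfP (UE : 'cV[R]_(udim N)) :
  payoff ^~ UE = quadf G (g0 - G *m UE) lambda (- lambda * dotv UE UE).
Proof.
apply/funext => UP; rewrite /payoff /Defs.payoff /quadf !norm2_sqr mulNr.
by rewrite /delta -(addrA (G *m UP)) (addrC (- _) g0).
Qed.

(** The squared norm ignores the sign of [delta], so the matrix can be [G] instead of [- G]. *)
Lemma payoff_quadfE (UP : 'cV[R]_(udim N)) :
  payoff UP = quadf G (- (g0 + G *m UP)) (- lambda) (lambda * dotv UP UP).
Proof.
apply/funext => UE; rewrite /payoff /Defs.payoff /quadf !norm2_sqr.
have -> : delta n dt xP xE UP UE = - (G *m UE - (g0 + G *m UP)).
  by rewrite /delta opprB addrC addrA.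
by rewrite dotvNl dotvNr opprK mulNr addrAC.
Qed.

(** The sign in front of the evader's gradient cancels the one with which [UE] enters [delta], so
    both components share [G^T delta]. *)
Lemma game_operator_col (UP UE : 'cV[R]_(udim N)) :
  game_operator n dt xP xE lambda (col_mx UP UE) =
  2 *: col_mx (G^T *m delta n dt xP xE UP UE + lambda *: UP)
              (G^T *m delta n dt xP xE UP UE + lambda *: UE).
Proof.
rewrite /game_operator col_mxKu col_mxKd (payoff_quadfP UE).
rewrite -[X in - gradient X _]/(payoff UP) (payoff_quadfE UP) !gradient_quadf.
rewrite scale_col_mx -scalerN; congr (col_mx (2 *: _) (2 *: _)).
  by rewrite /delta -(addrA (G *m UP)) (addrC (- _) g0).
rewrite scaleNr opprD opprK -mulmxN opprB; congr (G^T *m _ + _).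
by rewrite /delta [RHS]addrC addrA.
Qed.

(** With [(p, e) = z - z'] and [D = G p - G e], the shared term contributes
    [<D, G p + G e> = |G p|^2 - |G e|^2]. *)
Lemma game_operator_form (z z' : 'cV[R]_(udim N + udim N)) :
  dotv (game_operator n dt xP xE lambda z - game_operator n dt xP xE lambda z')
       (z - z') =
  2 * hessform G lambda (usubmx (z - z'))
  - 2 * hessform G (- lambda) (dsubmx (z - z')).
Proof.
rewrite -[z]vsubmxK -[z']vsubmxK.
move: (usubmx z) (dsubmx z) (usubmx z') (dsubmx z') => P E P' E'.
rewrite !game_operator_col -scalerBr !opp_col_mx !add_col_mx col_mxKu col_mxKd.
have deltaB : delta n dt xP xE P E - delta n dt xP xE P' E' =
              G *m (P - P') - G *m (E - E').
  rewrite /delta opprD addrACA subrr addr0 !mulmxBr opprD !opprK addrACA.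
  by rewrite opprD opprK.
have gradB h h' : G^T *m delta n dt xP xE P E + lambda *: h -
    (G^T *m delta n dt xP xE P' E' + lambda *: h') =
    G^T *m (G *m (P - P') - G *m (E - E')) + lambda *: (h - h').
  by rewrite -deltaB mulmxBr scalerBr opprD addrACA.
rewrite !gradB.
move: (P - P') (E - E') => p e.
rewrite dotv_lin dotv_col_mx /hessform !dotv_lin !dotv_trmul !dotv_lin.
rewrite (dotvC (G *m e) (G *m p)); ring.
Qed.

End Payoff.

Theorem proposition3 (R : realType) (n dt : R) (N : nat)
    (xP xE : 'cV[R]_4) (lambda : R) :
  0 < n -> 0 < dt -> (1 <= N)%N -> 0 < lambda ->
  [/\ (forall UE : 'cV[R]_(udim N),
         strictly_convex (fun UP => payoff n dt xP xE lambda UP UE)),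
      (forall UP : 'cV[R]_(udim N),
         concave (fun UE => payoff n dt xP xE lambda UP UE))
      <-> sigma_max (hcw_G n dt N) ^+ 2 <= lambda
    & monotone_operator (@game_operator R n dt N xP xE lambda)
      <-> sigma_max (hcw_G n dt N) ^+ 2 <= lambda].
Proof.
move=> _ _ N1 lambda0.
have udim0 : (0 < udim N)%N by rewrite udimE muln_gt0.
have sigmaE := sigma_max_sqr_le (hcw_G n dt N) lambda udim0.
have hessP_ge0 h : 0 <= hessform (hcw_G n dt N) lambda h.
  by rewrite addr_ge0 ?dotvv_ge0// mulr_ge0 ?dotvv_ge0// ltW.
have hessE h : hessform (hcw_G n dt N) (- lambda) h <= 0 <->
    dotv (hcw_G n dt N *m h) (hcw_G n dt N *m h) <= lambda * dotv h h.
  by rewrite /hessform mulNr subr_le0.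
split.
- move=> UE; rewrite payoff_quadfP; apply: strictly_convex_quadf => h h0.
  by rewrite ltr_wpDl ?dotvv_ge0// mulr_gt0// dotvv_gt0.
(* The second-order form in [UE] does not depend on [UP], so concavity at [UP = 0] suffices for the
   bound. *)
- rewrite sigmaE; split=> [cE h|le_lambda UP].
    apply/hessE; have := cE 0.
    rewrite -[X in concave X]/(payoff n dt xP xE lambda 0).
    by rewrite payoff_quadfE => /concave_quadf.
  rewrite -[X in concave X]/(payoff n dt xP xE lambda UP) payoff_quadfE.
  by apply/concave_quadf => h; apply/hessE.
- rewrite sigmaE; split=> [mF h|le_lambda z z'].
    (* Two points with the same pursuer control isolate the evader's form. *)
    have := mF (col_mx 0 h) 0.
    rewrite game_operator_form subr0 col_mxKu col_mxKd.
    by rewrite hessform0 => ?; apply/hessE; lra.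
  rewrite game_operator_form.
  have := hessP_ge0 (usubmx (z - z')).
  have /hessE := le_lambda (dsubmx (z - z')).
  lra.
Qed.
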